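(* Let $E=E_1(M_1,V_1,S_1)+E_2(M_2,V_2,S_2)+E_{\mathrm i}(S_{\mathrm i},A_{\mathrm i})$ be the extensive energy of the fluid-interface system, where $$M_k=y_kM,\quad V_k=\alpha_kV,\quad S_k=z_kS\ (k=1,2),\quad S_{\mathrm i}=z_{\mathrm i}S,\quad A_{\mathrm i}=a_{\mathrm i}V,$$ with $y_1+y_2=1$, $\alpha_1+\alpha_2=1$, $z_1+z_2+z_{\mathrm i}=1$, so that $E$ is a function of the independent variables $(M,V,S,a_{\mathrm i},y_1,\alpha_1,z_1,z_2)$. Then its total differential is $$\begin{aligned} \mathrm dE={}&(z_1T_1+z_2T_2+z_{\mathrm i}T_{\mathrm i})\,\mathrm dS-(\alpha_1p_1+\alpha_2p_2-a_{\mathrm i}\gamma_{\mathrm i})\,\mathrm dV+(y_1\mu_1+y_2\mu_2)\,\mathrm dM\\ &+S\big((T_1-T_{\mathrm i})\,\mathrm dz_1+(T_2-T_{\mathrm i})\,\mathrm dz_2\big)-V\big((p_1-p_2)\,\mathrm d\alpha_1-\gamma_{\mathrm i}\,\mathrm da_{\mathrm i}\big)+M(\mu_1-\mu_2)\,\mathrm dy_1 . \end{aligned}$$ As a consequence, the temperature, pressure and chemical potential of the fluid-interface system (the coefficients of $\mathrm dS$, $-\mathrm dV$ and $\mathrm dM$ respectively) are $$T:=z_1T_1+z_2T_2+z_{\mathrm i}T_{\mathrm i},\qquad p:=\alpha_1p_1+\alpha_2p_2-a_{\mathrm i}\gamma_{\mathrm i},\qquad \mu:=y_1\mu_1+y_2\mu_2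 .$$
   Context: The system has total mass $M$, volume $V$ and entropy $S$ and consists of two immiscible fluid phases $k=1,2$ and an interface (index $\mathrm i$) of area $A_{\mathrm i}$ with no mass and no volume. The constraints are $V=V_1+V_2$, $M=M_1+M_2$, $S=S_1+S_2+S_{\mathrm i}$. Each phase $k$ has an extensive energy $E_k(M_k,V_k,S_k)$ which is $\mathcal C^2$, convex and positively homogeneous of degree one. Its temperature, pressure and chemical potential are $T_k=\partial E_k/\partial S_k>0$, $p_k=-\partial E_k/\partial V_k$, $\mu_k=\partial E_k/\partial M_k$, i.e. $\mathrm dE_k=T_k\mathrm dS_k-p_k\mathrm dV_k+\mu_k\mathrm dM_k$. The interface has a differentiable energy $E_{\mathrm i}(S_{\mathrm i},A_{\mathrm i})$, positively homogeneous of degree one, with interfacial temperature $T_{\mathrm i}=\partial E_{\mathrm i}/\partial S_{\mathrm i}$ and surface tension $\gamma_{\mathrm i}=\partial E_{\mathrm i}/\partial A_{\mathrm i}$, i.e. $\mathrm dE_{\mathrm i}=T_{\mathrm i}\mathrm dS_{\mathrm i}+\gamma_{\mathrm i}\mathrm dA_{\mathrm i}$. The fractions are $y_k=M_k/M$, $\alpha_k=V_k/V$, $z_k=S_k/S$, $z_{\mathrm i}=S_{\mathrm i}/S$, all in $[0,1]$, and $a_{\mathrm i}=A_{\mathrm i}/V$ is the interfacial area density, with $M,V,S>0$. *)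

(* Defs.v *)
From mathcomp Require Import all_boot all_order all_algebra.
From mathcomp Require Import all_classical all_reals all_analysis.

Set Implicit Arguments.
Unset Strict Implicit.
Unset Printing Implicit Defensive.

Import Order.TTheory GRing.Theory Num.Theory numFieldNormedType.Exports.
Local Open Scope classical_set_scope.
Local Open Scope ring_scope.

(* Energies are total functions, but only their values on a domain [D] are
   meaningful.  [D] is always an open cone: a function positively homogeneous of
   degree one and differentiable at the origin is linear, so the
   natural domains are cones such as the open positive orthant. *)
Definition open_cone (R : realType) (V : normedModType R) (D : set V) : Prop :=
  open D /\ forall (c : R) (x : V), 0 < c -> D x -> D (c *: x).

Definition pos_homogeneous (R : realType) (V : normedModType R)
    (D : set V) (f : V -> R) : Prop :=
  forall (c : R) (x : V), 0 < c -> D x -> f (c *: x) = c * f x.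

(* Second-order differentiability of [f] on the open set [D], with the second
   differential [x |-> 'D_v ('D_u f) x] continuous.  As [V] is finite-dimensional
   in all uses, testing it in each pair of directions is the same as using the
   operator norm. *)
Definition C2_on (R : realType) (V : normedModType R)
    (D : set V) (f : V -> R) : Prop :=
  [/\ forall x, D x -> differentiable f x,
      forall u x, D x -> differentiable ('D_u f) x &
      forall u v x, D x -> {for x, continuous ('D_v ('D_u f))}].

Section Phase.
Variable R : realType.

(* A phase state is the triple (M_k, V_k, S_k). *)
Implicit Types (D : set (R * R * R)) (E : R * R * R -> R) (x : R * R * R).

Definition chemical_potential E x : R := 'D_((1, 0, 0) : R * R * R) E x.
Definition pressure E x : R := - 'D_((0, 1, 0) : R * R * R) E x.
Definition temperature E x : R := 'D_((0, 0, 1) : R * R * R) E x.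

Record phase_energy D E : Prop := PhaseEnergy {
  phase_domain_open_cone : open_cone D ;
  phase_domain_convex : convex_set D ;
  phase_energy_C2 : C2_on D E ;
  phase_energy_convex : convex_function D E ;
  phase_energy_homogeneous : pos_homogeneous D E ;
  phase_temperature_gt0 : forall x, D x -> 0 < temperature E x
}.

End Phase.

Section Interface.
Variable R : realType.

(* An interface state is the pair (S_i, A_i). *)
Implicit Types (D : set (R * R)) (E : R * R -> R) (x : R * R).

Definition interface_temperature E x : R := 'D_((1, 0) : R * R) E x.
Definition surface_tension E x : R := 'D_((0, 1) : R * R) E x.

Record interface_energy D E : Prop := InterfaceEnergy {
  interface_domain_open_cone : open_cone D ;
  interface_energy_differentiable : forall x, D x -> differentiable E x ;
  interface_energy_homogeneous : pos_homogeneous D E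
}.

End Interface.

(* The independent variables (M, V, S, a_i, y_1, alpha_1, z_1, z_2). *)
Notation state R := (R * R * R * R * R * R * R * R)%type.

Section System.
Variable R : realType.

(* y_2, alpha_2 and z_i are eliminated through y_1 + y_2 = 1,
   alpha_1 + alpha_2 = 1 and z_1 + z_2 + z_i = 1. *)
Definition system_energy (E1 E2 : R * R * R -> R) (Ei : R * R -> R)
    (q : state R) : R :=
  let '(m, v, s, ai, y1, al1, z1, z2) := q in
  E1 (y1 * m, al1 * v, z1 * s)
  + E2 ((1 - y1) * m, (1 - al1) * v, z2 * s)
  + Ei ((1 - z1 - z2) * s, ai * v).

(* The coefficients of dM, -dV and dS in the total differential of [E]. *)
Implicit Types (E : state R -> R) (q : state R).

Definition system_chemical_potential E q : R :=
  'd E q ((1, 0, 0, 0, 0, 0, 0, 0) : state R).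
Definition system_pressure E q : R :=
  - 'd E q ((0, 1, 0, 0, 0, 0, 0, 0) : state R).
Definition system_temperature E q : R :=
  'd E q ((0, 0, 1, 0, 0, 0, 0, 0) : state R).

End System.

(* Main.v *)
Require Import Defs.
From mathcomp Require Import all_boot all_order all_algebra.
From mathcomp Require Import all_classical all_reals all_analysis.
From mathcomp Require Import ring.
Import Order.TTheory GRing.Theory Num.Theory numFieldNormedType.Exports.
Local Open Scope classical_set_scope.
Local Open Scope ring_scope.

(** Every extensive variable is a fraction times a total, so the energy is a sum of three
    differentiable functions composed with products of coordinates. By the product rule,
    [d(y1 M) = y1 dM + M dy1], and likewise for the others. Inserting these into the Gibbs relation
    of each phase and of the interface ([diff_phase], [diff_interface]) gives [is_diff_phase] and
    [is_diff_interface]. The closure relations turn into [dy2 = - dy1], [dal2 = - dal1] and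
    [dzi = - dz1 - dz2]; collecting terms yields the differences of intensive quantities. The system
    temperature, pressure and chemical potential are then read off on basis vectors. *)

Section DifferentialCalculus.
Context {R : realType}.
Implicit Types U V W : normedModType R.

Lemma is_diff_fst {U V W} {f df : U -> V * W} {x : U} :
  is_diff x f df -> is_diff x (fun y => (f y).1) (fun y => (df y).1).
Proof.
have fst_diff (p : V * W) : is_diff p fst fst.
  have c : continuous (fst : V * W -> V) by move=> ?; exact: cvg_fst.
  by split; [exact: linear_differentiable|exact: diff_lin].
by move=> dfx; exact: is_diff_comp.
Qed.

Lemma is_diff_snd {U V W} {f df : U -> V * W} {x : U} :
  is_diff x f df -> is_diff x (fun y => (f y).2) (fun y => (df y).2).
Proof.
have snd_diff (p : V * W) : is_diff p snd snd.
  have c : continuous (snd : V * W -> W) by move=> ?; exact: cvg_snd.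
  by split; [exact: linear_differentiable|exact: diff_lin].
by move=> dfx; exact: is_diff_comp.
Qed.

(* [is_diffD] and [is_diffB] with the sums written pointwise, so that the
   resulting differentials beta-reduce when applied to a tuple. *)
Lemma is_diff_add {U} {f df g dg : U -> R} {x : U} :
  is_diff x f df -> is_diff x g dg ->
  is_diff x (fun y => f y + g y) (fun y => df y + dg y).
Proof. by move=> dfx dgx; exact: is_diffD. Qed.

Lemma is_diff_sub {U} {f df g dg : U -> R} {x : U} :
  is_diff x f df -> is_diff x g dg ->
  is_diff x (fun y => f y - g y) (fun y => df y - dg y).
Proof. by move=> dfx dgx; exact: is_diffB. Qed.

(** The base point [y] is kept apart from [f x] so that the differential of [g] can be expressed at
    a point written differently. *)
Lemma is_diff_chain {U V W} {f df : U -> V} {g : V -> W} {x : U} {y : V} :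
  y = f x -> differentiable g y -> is_diff x f df ->
  is_diff x (fun u => g (f u)) (fun u => 'd g y (df u)).
Proof. by move=> -> /differentiableP dg df_; apply: is_diff_comp. Qed.

(** Gibbs relation of a phase: a linear form is determined by its values on the basis, here the
    partial derivatives, with a sign for the pressure. *)
Lemma diff_phase (E : R * R * R -> R) x m v s : differentiable E x ->
  'd E x (m, v, s) =
  m * chemical_potential E x - v * pressure E x + s * temperature E x.
Proof.
move=> dE; rewrite /chemical_potential /pressure /temperature !deriveE//.
have -> : (m, v, s) = m *: ((1, 0, 0) : R * R * R)
    + v *: ((0, 1, 0) : R * R * R) + s *: ((0, 0, 1) : R * R * R).
  by congr (_, _, _) => /=; rewrite /GRing.scale/= !(mulr0,mulr1,addr0,add0r).
by rewrite !linearD !linearZ /= opprK.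
Qed.

Lemma diff_interface (E : R * R -> R) x s a : differentiable E x ->
  'd E x (s, a) = s * interface_temperature E x + a * surface_tension E x.
Proof.
move=> dE; rewrite /interface_temperature /surface_tension !deriveE//.
have -> : (s, a) = s *: ((1, 0) : R * R) + a *: ((0, 1) : R * R).
  by congr (_, _) => /=; rewrite /GRing.scale/= !(mulr0,mulr1,addr0,add0r).
by rewrite !linearD !linearZ.
Qed.

Lemma is_diff_phase {U} {E : R * R * R -> R}
    {f df g dg h dh k dk l dl n dn : U -> R} {x e} :
  differentiable E e ->
  is_diff x f df -> is_diff x g dg -> is_diff x h dh ->
  is_diff x k dk -> is_diff x l dl -> is_diff x n dn ->
  e = (f x * g x, h x * k x, l x * n x) ->
  is_diff x (fun u => E (f u * g u, h u * k u, l u * n u))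
    (fun u => (f x * dg u + g x * df u) * chemical_potential E e
            - (h x * dk u + k x * dh u) * pressure E e
            + (l x * dn u + n x * dl u) * temperature E e).
Proof.
move=> dE df_ dg_ dh_ dk_ dl_ dn_ ee; rewrite {}ee in dE *.
(* Folding the Gibbs relation back into ['d E] leaves a plain chain rule, whose inner differential
   comes from the product rule on each component. *)
under [X in is_diff_def _ _ X]eq_fun do rewrite -diff_phase//.
exact: is_diff_chain.
Qed.

Lemma is_diff_interface {U} {E : R * R -> R}
    {f df g dg h dh k dk : U -> R} {x e} :
  differentiable E e ->
  is_diff x f df -> is_diff x g dg -> is_diff x h dh -> is_diff x k dk ->
  e = (f x * g x, h x * k x) ->
  is_diff x (fun u => E (f u * g u, h u * k u))
    (fun u => (f x * dg u + g x * df u) * interface_temperature E e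
            + (h x * dk u + k x * dh u) * surface_tension E e).
Proof.
move=> dE df_ dg_ dh_ dk_ ee; rewrite {}ee in dE *.
under [X in is_diff_def _ _ X]eq_fun do rewrite -diff_interface//.
exact: is_diff_chain.
Qed.

End DifferentialCalculus.

Theorem proposition1 (R : realType)
    (D1 D2 : set (R * R * R)) (Di : set (R * R))
    (E1 E2 : R * R * R -> R) (Ei : R * R -> R)
    (hE1 : phase_energy D1 E1) (hE2 : phase_energy D2 E2)
    (hEi : interface_energy Di Ei)
    (M V S ai y1 y2 al1 al2 z1 z2 zi : R)
    (hM : 0 < M) (hV : 0 < V) (hS : 0 < S)
    (hy1 : 0 <= y1 <= 1) (hy2 : 0 <= y2 <= 1)
    (hal1 : 0 <= al1 <= 1) (hal2 : 0 <= al2 <= 1)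
    (hz1 : 0 <= z1 <= 1) (hz2 : 0 <= z2 <= 1) (hzi : 0 <= zi <= 1)
    (hy : y1 + y2 = 1) (hal : al1 + al2 = 1) (hz : z1 + z2 + zi = 1)
    (hD1 : D1 (y1 * M, al1 * V, z1 * S))
    (hD2 : D2 (y2 * M, al2 * V, z2 * S))
    (hDi : Di (zi * S, ai * V)) :
  let T1 := temperature E1 (y1 * M, al1 * V, z1 * S) in
  let p1 := pressure E1 (y1 * M, al1 * V, z1 * S) in
  let mu1 := chemical_potential E1 (y1 * M, al1 * V, z1 * S) in
  let T2 := temperature E2 (y2 * M, al2 * V, z2 * S) in
  let p2 := pressure E2 (y2 * M, al2 * V, z2 * S) in
  let mu2 := chemical_potential E2 (y2 * M, al2 * V, z2 * S) in
  let Ti := interface_temperature Ei (zi * S, ai * V) in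
  let gi := surface_tension Ei (zi * S, ai * V) in
  let E := system_energy E1 E2 Ei in
  let q := (M, V, S, ai, y1, al1, z1, z2) in
  [/\ differentiable E q,
      forall dM dV dS dai dy1 dal1 dz1 dz2 : R,
        'd E q (dM, dV, dS, dai, dy1, dal1, dz1, dz2) =
          (z1 * T1 + z2 * T2 + zi * Ti) * dS
          - (al1 * p1 + al2 * p2 - ai * gi) * dV
          + (y1 * mu1 + y2 * mu2) * dM
          + S * ((T1 - Ti) * dz1 + (T2 - Ti) * dz2)
          - V * ((p1 - p2) * dal1 - gi * dai)
          + M * (mu1 - mu2) * dy1 &
      [/\ system_temperature E q = z1 * T1 + z2 * T2 + zi * Ti,
          system_pressure E q = al1 * p1 + al2 * p2 - ai * gi &
          system_chemical_potential E q = y1 * mu1 + y2 * mu2]].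
Proof.
move=> T1 p1 mu1 T2 p2 mu2 Ti gi E q.
have ey : y2 = 1 - y1 by rewrite -hy; ring.
have eal : al2 = 1 - al1 by rewrite -hal; ring.
have ez : zi = 1 - z1 - z2 by rewrite -hz; ring.
have [/(_ _ hD1) dE1 _ _] := phase_energy_C2 hE1.
have [/(_ _ hD2) dE2 _ _] := phase_energy_C2 hE2.
have dEi := interface_energy_differentiable hEi hDi.
(* Tuples nest to the left: with coordinates numbered from 0, [dj] concerns the projection onto
   coordinates 0 to j, and its second component is coordinate j. *)
have d7 := is_diff_id q.
have d6 := is_diff_fst d7.
have d5 := is_diff_fst d6.
have d4 := is_diff_fst d5.
have d3 := is_diff_fst d4.
have d2 := is_diff_fst d3.
have dm := is_diff_fst (is_diff_fst d2).
have dv := is_diff_snd (is_diff_fst d2).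
have ds := is_diff_snd d2.
have da := is_diff_snd d3.
have dy := is_diff_snd d4.
have dal := is_diff_snd d5.
have dz1 := is_diff_snd d6.
have dz2 := is_diff_snd d7.
have d1 : is_diff q (fun=> 1 : R) (fun=> 0) by exact: is_diff_cst.
have P1 := is_diff_phase dE1 dy dm dal dv dz1 ds erefl.
(* [T2], [p2] and [mu2] are taken at the point written with [y2] and [al2], whereas the energy is
   differentiated through [1 - y1] and [1 - al1]. *)
have e2 : (y2 * M, al2 * V, z2 * S) = ((1 - y1) * M, (1 - al1) * V, z2 * S).
  by rewrite ey eal.
have P2 := is_diff_phase dE2 (is_diff_sub d1 dy) dm (is_diff_sub d1 dal) dv
  dz2 ds e2.
have ei : (zi * S, ai * V) = ((1 - z1 - z2) * S, ai * V) by rewrite ez.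
have Pi := is_diff_interface dEi (is_diff_sub (is_diff_sub d1 dz1) dz2) ds da dv
  ei.
have [] := is_diff_add (is_diff_add P1 P2) Pi.
(* [system_energy] matches on the tuple, while the assembled function uses projections; they agree
   once the tuple is destructed. *)
rewrite (_ : (fun u => _) = E); last first.
  by apply/funext => -[[[[[[[? ?] ?] ?] ?] ?] ?] ?].
move=> dE Eq.
have dEE dM dV dS dai dy1 dal1 dz1' dz2' :
    'd E q (dM, dV, dS, dai, dy1, dal1, dz1', dz2') =
      (z1 * T1 + z2 * T2 + zi * Ti) * dS
      - (al1 * p1 + al2 * p2 - ai * gi) * dV
      + (y1 * mu1 + y2 * mu2) * dM
      + S * ((T1 - Ti) * dz1' + (T2 - Ti) * dz2')
      - V * ((p1 - p2) * dal1 - gi * dai)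
      + M * (mu1 - mu2) * dy1.
  (* With the intensive quantities folded into atoms, only a polynomial identity remains after
     eliminating [y2], [al2] and [zi]. *)
  rewrite Eq /= -/T1 -/T2 -/Ti -/p1 -/p2 -/mu1 -/mu2 -/gi.
  rewrite ey eal ez; ring.
by split=> //; split; rewrite /system_temperature /system_pressure
  /system_chemical_potential dEE; ring.
Qed.
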